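(* For a positive integer $n$, $$\left\lfloor \zeta_n^*(4)^{-1}\right\rfloor=\begin{cases}-(2n^4-4n^3+8n^2-6n-8)-1 & \text{if } n\geq 10 \text{ is even},\\ 2n^4-4n^3+8n^2-6n-8 & \text{if } n\geq 11 \text{ is odd}.\end{cases}$$
   Context: For a positive integer $n$ and $s$ with $\Re(s)>0$, $\zeta_n^*(s)=\sum_{k=n}^{\infty}\frac{(-1)^{k+1}}{k^s}$ is the tail of the alternating Riemann zeta function. $\lfloor x\rfloor$ denotes the largest integer less than or equal to the real number $x$. *)

(* Defs.v *)
From Stdlib Require Import Reals Lra Lia ZArith.
From Coquelicot Require Import Coquelicot.
Open Scope R_scope.

(* The k-th term (-1)^(k+1) / k^s, for k >= 1 and real s.  At k = 0 the value
   of [Rpower 0 s] is a junk value; the terms are only used for k >= n >= 1. *)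
Definition alt_zeta_term (s : R) (k : nat) : R :=
  (-1) ^ (k + 1) / Rpower (INR k) s.

(* sum_(k >= n) (-1)^(k+1) / k^s, reindexed by k = n + j.  [Series] is the limit
   of the partial sums; it is total, and [ex_series_alt_zeta_tail] shows that
   the limit exists in the range s > 0. *)
Definition alt_zeta_tail (n : nat) (s : R) : R :=
  Series (fun j : nat => alt_zeta_term s (n + j)).

Lemma ex_series_alt_zeta_tail (n : nat) (s : R) :
  (1 <= n)%nat -> 0 < s -> ex_series (fun j : nat => alt_zeta_term s (n + j)).
Proof.
  intros Hn Hs.
  set (U := fun j : nat => / Rpower (INR (n + j)) s).
  assert (Hpos : forall j, 0 < INR (n + j)) by (intro j; apply lt_0_INR; lia).
  assert (Hdec : Un_decreasing U).
  { intro j; unfold U.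
    apply Rinv_le_contravar; [apply exp_pos|].
    apply Rle_Rpower_l; [lra|].
    split; [apply Hpos|apply le_INR; lia]. }
  assert (Hcv : Un_cv U 0).
  { apply is_lim_seq_Reals.
    replace (Finite 0) with (Rbar_inv p_infty) by reflexivity.
    apply is_lim_seq_inv; [|discriminate].
    unfold Rpower.
    apply (is_lim_comp_seq exp _ p_infty p_infty is_lim_exp_p).
    { exists 0%nat; intros; discriminate. }
    replace p_infty with (Rbar_mult s p_infty).
    2:{ apply is_Rbar_mult_unique. apply is_Rbar_mult_sym.
        apply is_Rbar_mult_p_infty_pos; exact Hs. }
    apply is_lim_seq_scal_l.
    apply (is_lim_comp_seq ln _ p_infty p_infty is_lim_ln_p).
    { exists 0%nat; intros; discriminate. }
    apply is_lim_seq_ext with (fun j => INR (j + n)).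
    { intro j; f_equal; lia. }
    apply (is_lim_seq_incr_n INR n p_infty), is_lim_seq_INR. }
  destruct (alternated_series U Hdec Hcv) as [l Hl].
  assert (Halt : ex_series (tg_alt U)) by (exists l; apply is_series_Reals;
    intros e He; destruct (Hl e He) as [N HN]; exists N; exact HN).
  apply ex_series_ext with (fun j => scal ((-1) ^ (n + 1)) (tg_alt U j)).
  - intro j; unfold alt_zeta_term, tg_alt, U, scal; simpl; unfold mult; simpl.
    replace (n + j + 1)%nat with (n + 1 + j)%nat by lia.
    rewrite (pow_add (-1) (n + 1) j); unfold Rdiv; ring.
  - exact (ex_series_scal ((-1) ^ (n + 1)) (tg_alt U) Halt).
Qed.

(* Main.v *)
(** Write [T n] for the sum over [j >= 0] of [(-1)^j / (n+j)^4] and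
    [P n = 2n^4 - 4n^3 + 8n^2 - 6n - 8], so that the tail is [T n] for odd [n] and
    [- T n] for even [n]; both cases amount to [1 / (P n + 1) < T n < 1 / P n].
    Grouping the terms of [T n] in pairs, these bounds follow by telescoping from
    [g n - g (n+2)] compared with [1 / n^4 - 1 / (n+1)^4] for [g = 1 / P] and
    [g = 1 / (P + 1)].  After clearing denominators each comparison is a polynomial
    inequality in [n], whose expansion around [n = 10] has coefficients of one sign. *)
Require Import Defs.
From Stdlib Require Import Reals ZArith Lra Lia.
From Coquelicot Require Import Coquelicot.
Open Scope R_scope.

(** Summing the pairwise bounds telescopes to [h 0 - h (k+1)], and the subtracted term vanishes in
    the limit. *)
Lemma Series_lt_telescope (u h : nat -> R) :
  ex_series u -> is_lim_seq h 0 ->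
  (forall k, u (2 * k)%nat + u (S (2 * k)) < h k - h (S k)) ->
  Series u < h 0%nat.
Proof.
  intros Hu Hh Hlt.
  (* Limits preserve only [<=], so the positive slack of the first pair is carried through every
     partial sum to keep the final inequality strict. *)
  set (gap := h 0%nat - h 1%nat - (u 0%nat + u 1%nat)).
  assert (Hgap : 0 < gap) by (specialize (Hlt 0%nat); unfold gap; simpl in Hlt; lra).
  assert (Hle : forall k, sum_n u (S (2 * k)) <= h 0%nat - h (S k) - gap).
  { induction k as [|k IH].
    - rewrite sum_Sn, sum_O; unfold plus; simpl; unfold gap; lra.
    - specialize (Hlt (S k)).
      replace (2 * S k)%nat with (S (S (2 * k))) in * by lia.
      rewrite 2!sum_Sn; unfold plus in *; simpl in *; lra. }
  enough (Series u <= h 0%nat - 0 - gap) by lra.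
  apply (is_lim_seq_le _ _ (Series u) (h 0%nat - 0 - gap) Hle).
  (* Only partial sums made of whole pairs are bounded; as the series converges, this subsequence
     has the same limit. *)
  - apply (is_lim_seq_subseq (sum_n u) _ (fun k => S (2 * k))).
    + apply eventually_subseq; intro k; lia.
    + exact (Series_correct u Hu).
  - apply is_lim_seq_minus'; [|apply is_lim_seq_const].
    apply is_lim_seq_minus'; [apply is_lim_seq_const|].
    exact (proj1 (is_lim_seq_incr_1 h 0) Hh).
Qed.

Lemma Series_gt_telescope (u h : nat -> R) :
  ex_series u -> is_lim_seq h 0 ->
  (forall k, h k - h (S k) < u (2 * k)%nat + u (S (2 * k))) ->
  h 0%nat < Series u.
Proof.
  intros Hu Hh Hlt.
  enough (Series (fun k => - u k) < - h 0%nat) by (rewrite Series_opp in H; lra).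
  apply (Series_lt_telescope (fun k => - u k) (fun k => - h k)).
  - exact (ex_series_opp u Hu).
  - replace 0 with (- 0) by ring; exact (proj1 (is_lim_seq_opp h 0) Hh).
  - intro k; specialize (Hlt k); lra.
Qed.

(** The polynomial part of the asymptotic expansion of [1 / T n] at infinity; the next nonzero term
    is [82 / n^2], which explains a fractional part in [(0, 1)] for large [n]. *)
Definition quartic (x : R) : R := 2 * x ^ 4 - 4 * x ^ 3 + 8 * x ^ 2 - 6 * x - 8.

(** A crude bound that serves twice: it makes the denominators positive and forces [1 / quartic] to
    tend to 0. *)
Lemma quartic_gt (x : R) : 10 <= x -> x < quartic x.
Proof.
  intro Hx; replace x with (x - 10 + 10) by ring.
  set (m := x - 10); assert (0 <= m) by (unfold m; lra).
  pose proof (pow_le m 2 H); pose proof (pow_le m 3 H); pose proof (pow_le m 4 H).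
  unfold quartic; ring_simplify; lra.
Qed.

Lemma is_lim_seq_inv_quartic (n : nat) (c : R) :
  (10 <= n)%nat -> 0 <= c ->
  is_lim_seq (fun k => / (quartic (INR (n + 2 * k)) + c)) 0.
Proof.
  intros Hn Hc.
  replace (Finite 0) with (Rbar_inv p_infty) by reflexivity.
  apply is_lim_seq_inv; [|discriminate].
  apply is_lim_seq_le_p_loc with INR; [|apply is_lim_seq_INR].
  exists 0%nat; intros k _.
  pose proof (le_INR 10 (n + 2 * k)) as H1; pose proof (le_INR k (n + 2 * k)) as H2.
  pose proof (quartic_gt (INR (n + 2 * k))) as H3; simpl INR in H1 at 1.
  specialize (H1 ltac:(lia)); specialize (H2 ltac:(lia)).
  specialize (H3 ltac:(lra)); lra.
Qed.

Lemma pair_lt_telescope (x : R) :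
  10 <= x ->
  / x ^ 4 - / (x + 1) ^ 4 < / quartic x - / quartic (x + 2).
Proof.
  intro Hx.
  pose proof (quartic_gt x Hx) as H1; pose proof (quartic_gt (x + 2) ltac:(lra)) as H2.
  assert (H3 : 0 < x ^ 4) by (apply pow_lt; lra).
  assert (H4 : 0 < (x + 1) ^ 4) by (apply pow_lt; lra).
  apply Rminus_lt_0.
  (* Right side minus left side over a common positive denominator, so only the sign of the
     numerator matters. *)
  replace (_ - _) with
    (((quartic (x + 2) - quartic x) * x ^ 4 * (x + 1) ^ 4
      - ((x + 1) ^ 4 - x ^ 4) * quartic x * quartic (x + 2))
     * / (quartic x * quartic (x + 2) * x ^ 4 * (x + 1) ^ 4))
    by (field; repeat split; try apply pow_nonzero; lra).
  apply Rmult_lt_0_compat.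
  2:{ apply Rinv_0_lt_compat; repeat apply Rmult_lt_0_compat; lra. }
  clear H1 H2 H3 H4; unfold quartic.
  (* In powers of [m = x - 10 >= 0] the numerator has positive coefficients, so [lra] concludes with
     each power of [m] as a nonnegative atom. *)
  replace x with (x - 10 + 10) by ring.
  set (m := x - 10); assert (Hm : 0 <= m) by (unfold m; lra); clearbody m.
  pose proof (fun k => pow_le m k Hm) as Hp.
  ring_simplify.
  pose proof (Hp 2%nat); pose proof (Hp 3%nat); pose proof (Hp 4%nat); pose proof (Hp 5%nat).
  pose proof (Hp 6%nat); pose proof (Hp 7%nat); pose proof (Hp 8%nat); pose proof (Hp 9%nat).
  lra.
Qed.

Lemma pair_gt_telescope (x : R) :
  10 <= x ->
  / (quartic x + 1) - / (quartic (x + 2) + 1) < / x ^ 4 - / (x + 1) ^ 4.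
Proof.
  intro Hx.
  pose proof (quartic_gt x Hx) as H1; pose proof (quartic_gt (x + 2) ltac:(lra)) as H2.
  assert (H3 : 0 < x ^ 4) by (apply pow_lt; lra).
  assert (H4 : 0 < (x + 1) ^ 4) by (apply pow_lt; lra).
  apply Rminus_lt_0.
  replace (_ - _) with
    ((((x + 1) ^ 4 - x ^ 4) * (quartic x + 1) * (quartic (x + 2) + 1)
      - (quartic (x + 2) - quartic x) * x ^ 4 * (x + 1) ^ 4)
     * / ((quartic x + 1) * (quartic (x + 2) + 1) * x ^ 4 * (x + 1) ^ 4))
    by (field; repeat split; try apply pow_nonzero; lra).
  apply Rmult_lt_0_compat.
  2:{ apply Rinv_0_lt_compat; repeat apply Rmult_lt_0_compat; lra. }
  clear H1 H2 H3 H4; unfold quartic.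
  replace x with (x - 10 + 10) by ring.
  set (m := x - 10); assert (Hm : 0 <= m) by (unfold m; lra); clearbody m.
  pose proof (fun k => pow_le m k Hm) as Hp.
  ring_simplify.
  pose proof (Hp 2%nat); pose proof (Hp 3%nat); pose proof (Hp 4%nat); pose proof (Hp 5%nat).
  pose proof (Hp 6%nat); pose proof (Hp 7%nat); pose proof (Hp 8%nat); pose proof (Hp 9%nat).
  lra.
Qed.

Lemma alt_zeta_term_4 (k : nat) :
  (1 <= k)%nat -> alt_zeta_term 4 k = (-1) ^ (k + 1) * / INR k ^ 4.
Proof.
  intro Hk; unfold alt_zeta_term, Rdiv.
  replace 4 with (INR 4) by (simpl; ring).
  rewrite Rpower_pow; [reflexivity | apply lt_0_INR; lia].
Qed.

(** The factor [(-1)^(n+1)] makes the leading term positive, so both parities of [n] are treated at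
    once. *)
Lemma signed_alt_zeta_tail_4_bounds (n : nat) :
  (10 <= n)%nat ->
  / (quartic (INR n) + 1) < (-1) ^ (n + 1) * alt_zeta_tail n 4 < / quartic (INR n).
Proof.
  intro Hn.
  set (u := fun j => (-1) ^ (n + 1) * alt_zeta_term 4 (n + j)).
  assert (Hu : ex_series u).
  { apply (ex_series_scal ((-1) ^ (n + 1)) (fun j => alt_zeta_term 4 (n + j))).
    apply ex_series_alt_zeta_tail; [lia | lra]. }
  replace (_ * alt_zeta_tail n 4) with (Series u) by apply Series_scal_l.
  assert (Hpair : forall k, u (2 * k)%nat + u (S (2 * k)) =
            / INR (n + 2 * k) ^ 4 - / (INR (n + 2 * k) + 1) ^ 4).
  { intro k; unfold u; rewrite 2!alt_zeta_term_4 by lia.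
    replace (n + S (2 * k))%nat with (S (n + 2 * k)) by lia.
    rewrite S_INR, <- 2!Rmult_assoc, <- 2!pow_add.
    (* The combined sign exponent is even for the first term of a pair and odd for the second. *)
    replace (n + 1 + (n + 2 * k + 1))%nat with (2 * (n + k + 1))%nat by lia.
    replace (n + 1 + (S (n + 2 * k) + 1))%nat with (S (2 * (n + k + 1))) by lia.
    rewrite pow_1_even, pow_1_odd; ring. }
  assert (Hx : forall k, 10 <= INR (n + 2 * k)).
  { intro k; replace 10 with (INR 10) by (simpl; ring); apply le_INR; lia. }
  assert (Hstep : forall k, INR (n + 2 * S k) = INR (n + 2 * k) + 2).
  { intro k; replace (n + 2 * S k)%nat with (n + 2 * k + 2)%nat by lia.
    rewrite (plus_INR _ 2); simpl; ring. }
  split.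
  - replace n with (n + 2 * 0)%nat at 1 by lia.
    apply (Series_gt_telescope u (fun k => / (quartic (INR (n + 2 * k)) + 1)) Hu).
    + apply is_lim_seq_inv_quartic; [exact Hn | lra].
    + intro k; rewrite Hpair, Hstep; apply pair_gt_telescope, Hx.
  - replace n with (n + 2 * 0)%nat by lia.
    apply (Series_lt_telescope u (fun k => / quartic (INR (n + 2 * k))) Hu).
    + eapply is_lim_seq_ext; [|apply (is_lim_seq_inv_quartic n 0 Hn); lra].
      intro k; simpl; now rewrite Rplus_0_r.
    + intro k; rewrite Hpair, Hstep; apply pair_lt_telescope, Hx.
Qed.

Lemma IZR_quartic (n : nat) :
  IZR (2 * Z.of_nat n ^ 4 - 4 * Z.of_nat n ^ 3 + 8 * Z.of_nat n ^ 2
       - 6 * Z.of_nat n - 8) = quartic (INR n).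
Proof.
  rewrite INR_IZR_INZ; unfold quartic.
  rewrite !minus_IZR, plus_IZR, minus_IZR, !mult_IZR, !pow_IZR.
  reflexivity.
Qed.

Lemma inv_between (a b x : R) : 0 < a -> 0 < b -> / b < x < / a -> a < / x < b.
Proof.
  intros Ha Hb [H1 H2].
  pose proof (Rinv_0_lt_compat b Hb) as Hb'.
  rewrite <- (Rinv_inv a), <- (Rinv_inv b).
  split; apply Rinv_lt_contravar; try assumption; apply Rmult_lt_0_compat; lra.
Qed.

Theorem theorem1p4 (n : nat) (hn : (1 <= n)%nat) :
  ((10 <= n)%nat -> Nat.Even n ->
     Zfloor (/ alt_zeta_tail n 4) =
       (- (2 * Z.of_nat n ^ 4 - 4 * Z.of_nat n ^ 3 + 8 * Z.of_nat n ^ 2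
           - 6 * Z.of_nat n - 8) - 1)%Z) /\
  ((11 <= n)%nat -> Nat.Odd n ->
     Zfloor (/ alt_zeta_tail n 4) =
       (2 * Z.of_nat n ^ 4 - 4 * Z.of_nat n ^ 3 + 8 * Z.of_nat n ^ 2
        - 6 * Z.of_nat n - 8)%Z).
Proof.
  assert (Hinv : (10 <= n)%nat ->
    quartic (INR n) < / ((-1) ^ (n + 1) * alt_zeta_tail n 4) < quartic (INR n) + 1).
  { intro Hn; pose proof (le_INR 10 n Hn) as Hx; simpl INR in Hx at 1.
    pose proof (quartic_gt (INR n) ltac:(lra)).
    apply inv_between; [lra | lra | exact (signed_alt_zeta_tail_4_bounds n Hn)]. }
  split; intros Hn [k Hk]; specialize (Hinv ltac:(lia)); apply Zfloor_eq.
  (* Here the reciprocal lies strictly between [-P - 1] and [-P]; the strict upper end excludes the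
     floor [-P]. *)
  - replace (n + 1)%nat with (S (2 * k)) in Hinv by lia.
    rewrite pow_1_odd in Hinv.
    replace (-1 * alt_zeta_tail n 4) with (- alt_zeta_tail n 4) in Hinv by ring.
    rewrite Rinv_opp in Hinv.
    rewrite minus_IZR, opp_IZR, IZR_quartic; lra.
  (* For odd [n] the sign is [+1], and the strict bound by [P + 1] gives the floor [P]. *)
  - replace (n + 1)%nat with (2 * (k + 1))%nat in Hinv by lia.
    rewrite pow_1_even, Rmult_1_l in Hinv.
    rewrite IZR_quartic; lra.
Qed.
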